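(* Let $X$ be a complete proper geodesic metric space with basepoint $x_0$, and let $\overline{X}=X\cup\partial X$ be a Hausdorff bordification of $X$ that is compact and first countable. Let $\xi,\eta\in\partial X$. Then $\eta\in\mathsf{S}(\xi)$ if and only if for every neighborhood $U$ of $\eta$ in $\overline{X}$ there are sequences $(x_n)$, $(y_n)$ in $X$ with $x_n\to\xi$ and $y_n\to U$, and a constant $C\ge 0$, such that for all $n$ $$d(y_n,x_n)\le d(y_n,x_0)+C.$$ In particular, if there exist $C\ge 0$ and sequences $(x_n)$, $(y_n)$ in $X$ with $x_n\to\xi$ and $y_n\to\eta$ such that $d(y_n,x_n)\le d(y_n,x_0)+C$ for all $n$, then $\eta\in\mathsf{S}(\xi)$.
   Context: A Hausdorff bordification of $X$ is a Hausdorff topological space $\overline{X}$ in which $X$ is embedded as an open dense subset; $\partial X=\overline{X}\setminus X$. The notation $y_n\to U$ means that $y_n\in U$ for all sufficiently large $n$. Stars: for $W\subset X$ nonempty and $C\ge 0$, the halfspace is $H(W,C)=\{z\in X: d(z,W)\le d(z,x_0)+C\}$; for $V$ an open subset of $\overline{X}$, $H(V,C)$ means $H(V\cap X,C)$. For $\xi\in\partial X$ let $\mathcal{V}_\xi$ be the collection of open neighborhoods of $\xi$ in $\overline{X}$. The star of $\xi$ is $$\mathsf{S}(\xi)=\overline{\bigcup_{C\ge 0}\ \bigcap_{V\in\mathcal{V}_\xi}\overline{H(V,C)}},$$ with closures taken in $\overline{X}$. It does not depend on the choice of $x_0$. *)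

(* Defs.v *)
From mathcomp Require Import all_boot all_order all_algebra.
From mathcomp Require Import all_classical all_reals all_analysis.

Set Implicit Arguments.
Unset Strict Implicit.
Unset Printing Implicit Defensive.

Import Order.TTheory GRing.Theory Num.Theory.
Import numFieldNormedType.Exports.

Local Open Scope classical_set_scope.
Local Open Scope ring_scope.

(* The library's [completeType] also carries a distinguished point; this is its
   completeness condition alone. *)
Definition complete_metric (R : realType) (X : metricType R) : Prop :=
  forall F : set_system X, ProperFilter F -> cauchy F -> exists l : X, F --> l.

(* The library's [closed_ball x r] is the closure of the open ball, which in a
   general metric space may be smaller than the ball used here. *)
Definition proper_metric (R : realType) (X : metricType R) : Prop :=
  forall (x : X) (r : R), compact [set y : X | mdist x y <= r].

Definition geodesic_metric (R : realType) (X : metricType R) : Prop :=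
  forall x y : X, exists gamma : R -> X,
    [/\ gamma 0 = x, gamma (mdist x y) = y &
        forall s t : R, 0 <= s <= mdist x y -> 0 <= t <= mdist x y ->
          mdist (gamma s) (gamma t) = `|s - t|].

Definition topological_embedding (S T : topologicalType) (i : S -> T) : Prop :=
  injective i /\
  forall A : set S, open A <-> exists2 B : set T, open B & i @^-1` B = A.

Definition first_countable (T : topologicalType) : Prop :=
  forall x : T, exists B : set (set T),
    [/\ countable B, B `<=` nbhs x &
        forall A : set T, nbhs x A -> exists2 U, B U & U `<=` A].

Definition hausdorff_bordification (S T : topologicalType) (i : S -> T) : Prop :=
  [/\ hausdorff_space T, topological_embedding i, open (range i) &
      dense (range i)].

Definition bord_boundary (S T : topologicalType) (i : S -> T) : set T :=
  ~` range i.

(* Meaningful for nonempty [W] only: by convention [inf set0 = 0]. *)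
Definition dist_set (R : realType) (X : metricType R) (z : X) (W : set X) : R :=
  inf [set mdist z w | w in W].

Definition halfspace (R : realType) (X : metricType R) (x0 : X)
    (W : set X) (C : R) : set X :=
  [set z | dist_set z W <= mdist z x0 + C].

(* For open [V] in [Xbar], [i @^-1` V] is the trace of [V] on [X]; it is
   nonempty whenever [V] is, if [range i] is dense. *)
Definition star (R : realType) (X : metricType R) (x0 : X)
    (Xbar : topologicalType) (i : X -> Xbar) (xi : Xbar) : set Xbar :=
  closure (\bigcup_(C in [set C : R | 0 <= C])
             \bigcap_(V in open_nbhs xi)
               closure (i @` halfspace x0 (i @^-1` V) C)).

(* Main.v *)
Require Import Defs.
From mathcomp Require Import all_boot all_order all_algebra.
From mathcomp Require Import all_classical all_reals all_analysis.

Import Order.TTheory GRing.Theory Num.Theory.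
Import numFieldNormedType.Exports.

Local Open Scope classical_set_scope.
Local Open Scope ring_scope.

(** Membership of a point [z] in the halfspace of [W] means that some point of
    [W] is, up to an additive error, at distance at most [mdist z x0] from [z];
    this is [mem_halfspace] in one direction and [halfspace_near_point], with
    error [1], in the other.

    If [eta] is in the star, every neighborhood [U] of [eta] contains a point
    [p] which, for one constant [C], is a limit of every halfspace
    [halfspace x0 (i @^-1` V) C]. Letting [V] run through a shrinking sequence
    of neighborhoods of [xi] and picking in each halfspace a point [y n] with
    [i (y n)] in [U], then a nearly closest point [x n] of [i @^-1` V], gives
    the sequences, with constant [C + 1].

    Conversely, sequences [x] and [y] as in the theorem put [y n] eventually in
    every halfspace [halfspace x0 (i @^-1` V) C], so each cluster point of
    [i \o y] is in the closure of all of them at once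
    ([cluster_limit_halfspaces]). By compactness there is such a cluster point,
    and it is as close to [eta] as desired because compact Hausdorff spaces are
    regular. This presents [eta] as a limit of such points, for constants [C]
    that may vary; the outer closure in [star] absorbs both. *)

(** An enumeration of a countable local base becomes a shrinking sequence once
    interiors are taken and each member is intersected with its predecessors. *)
Lemma first_countable_shrinking_nbhs {T : topologicalType} (x : T) :
  first_countable T ->
  exists V : nat -> set T,
    (forall n, open_nbhs x (V n)) /\
    forall A, nbhs x A -> \forall n \near \oo, V n `<=` A.
Proof.
move=> /(_ x) [B [cB Bx Bbase]].
have [B0|[f]] := pfcard_geP cB.
  have [U + _] := Bbase setT filterT; by rewrite B0.
pose V n := \big[setI/setT]_(k < n) (f k)°.
exists V; split=> [n|A /Bbase [U BU UA]].
  rewrite /V; elim: n => [|n IHn].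
    by rewrite big_ord0; split; [exact: openT|].
  rewrite big_ord_recr /=; apply: open_nbhsI => //.
  split; first exact: open_interior.
  by apply/Bx/funS.
have [k _ fkU] := 'surj_f BU.
near=> n; rewrite /V -(bigcap_mkord n (fun k => (f k)°)) => z /(_ k) Vz.
suff kn : (k < n)%N by apply: UA; rewrite -fkU; exact: interior_subset (Vz kn).
by near: n; exact: nbhs_infty_gt.
Unshelve. all: by end_near. Qed.

Section Halfspaces.
Context {R : realType} {X : metricType R}.
Implicit Types (w z : X) (W : set X) (C : R).

Lemma has_lbound_dist z W : has_lbound [set mdist z w | w in W].
Proof. by exists 0 => _ [w _ <-]; exact: mdist_ge0. Qed.

Lemma mem_halfspace {x0 : X} {W C w z} :
  W w -> mdist z w <= mdist z x0 + C -> halfspace x0 W C z.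
Proof.
move=> Ww; apply: le_trans.
by apply: ge_inf; [exact: has_lbound_dist|exists w].
Qed.

(** The infimum defining [dist_set z W] need not be attained, which costs an
    additive error; [1] is an arbitrary choice. *)
Lemma halfspace_near_point {x0 : X} {W C z} : W !=set0 -> halfspace x0 W C z ->
  exists2 w, W w & mdist z w <= mdist z x0 + (C + 1).
Proof.
move=> [w0 Ww0] Hz.
have hinf : has_inf [set mdist z w | w in W].
  by split; [exists (mdist z w0), w0|exact: has_lbound_dist].
have [_ [w Ww <-] lew] := inf_adherent ltr01 hinf.
exists w => //; apply/ltW/(lt_le_trans lew).
by rewrite addrA lerD2r.
Qed.

End Halfspaces.

(** The union of these sets over [0 <= C] is the set whose closure is
    [star x0 i xi]. *)
Definition limit_halfspaces {R : realType} {X : metricType R} (x0 : X)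
    {Xbar : topologicalType} (i : X -> Xbar) (xi : Xbar) (C : R) : set Xbar :=
  \bigcap_(V in open_nbhs xi) closure (i @` halfspace x0 (i @^-1` V) C).

Section StarOfLimits.
Context {R : realType} {X : metricType R} (x0 : X).
Context {Xbar : topologicalType} (i : X -> Xbar) (xi : Xbar).

Lemma cluster_limit_halfspaces {x y : nat -> X} {C : R} :
  i (x n) @[n --> \oo] --> xi ->
  (forall n, mdist (y n) (x n) <= mdist (y n) x0 + C) ->
  cluster (i (y n) @[n --> \oo]) `<=` limit_halfspaces x0 i xi C.
Proof.
move=> xxi le_yx p clp V Vxi N Np; apply: clp Np.
have xV : \forall n \near \oo, V (i (x n)) := xxi V (open_nbhs_nbhs Vxi).
rewrite /= nbhs_simpl /=; apply: filterS xV => n Vxn.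
by exists (y n) => //; exact: mem_halfspace Vxn (le_yx n).
Qed.

Lemma limit_halfspaces_sequences {p : Xbar} {C : R} {U : set Xbar} :
  dense (range i) -> first_countable Xbar ->
  limit_halfspaces x0 i xi C p -> nbhs p U ->
  exists x y : nat -> X,
    [/\ i (x n) @[n --> \oo] --> xi, forall n, U (i (y n)) &
        forall n, mdist (y n) (x n) <= mdist (y n) x0 + (C + 1)].
Proof.
move=> densei fc Hp pU.
have [V [Vxi Vbase]] := first_countable_shrinking_nbhs xi fc.
have /choice[xy xyP] : forall n, exists xy : X * X,
    [/\ V n (i xy.1), U (i xy.2) &
        mdist xy.2 xy.1 <= mdist xy.2 x0 + (C + 1)].
  move=> n; have [_ [[y Hy <-] Uy]] := Hp _ (Vxi n) _ pU.
  (* density makes the trace of [V n] nonempty, so that [dist_set] is a true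
     infimum *)
  have Vn0 : i @^-1` V n !=set0.
    have [oV Vnxi] := Vxi n.
    have [|z [Vz [w _ wz]]] := densei (V n) _ oV; first by exists xi.
    by exists w; rewrite /preimage /= wz.
  by have [x Vx le_yx] := halfspace_near_point Vn0 Hy; exists (x, y).
exists (fun n => (xy n).1), (fun n => (xy n).2); split=> [A /Vbase|n|n].
- by apply: filterS => n VA; apply: VA; have [] := xyP n.
- by have [] := xyP n.
- by have [] := xyP n.
Qed.

End StarOfLimits.

Theorem lemmaC (R : realType) (X : metricType R) (x0 : X)
    (Xbar : topologicalType) (i : X -> Xbar)
    (completeX : complete_metric X) (properX : proper_metric X)
    (geodesicX : geodesic_metric X)
    (bordX : hausdorff_bordification i)
    (compactXbar : compact [set: Xbar]) (fcXbar : first_countable Xbar)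
    (xi eta : Xbar) (xi_bd : bord_boundary i xi) (eta_bd : bord_boundary i eta) :
  (star x0 i xi eta <->
     forall U : set Xbar, nbhs eta U ->
       exists (x y : nat -> X) (C : R),
         [/\ 0 <= C,
             i (x n) @[n --> \oo] --> xi,
             (\forall n \near \oo, U (i (y n))) &
             forall n : nat, mdist (y n) (x n) <= mdist (y n) x0 + C])
  /\
  ((exists (C : R) (x y : nat -> X),
      [/\ 0 <= C,
          i (x n) @[n --> \oo] --> xi,
          i (y n) @[n --> \oo] --> eta &
          forall n : nat, mdist (y n) (x n) <= mdist (y n) x0 + C]) ->
   star x0 i xi eta).
Proof.
have [hausXbar _ _ densei] := bordX.
have starP : star x0 i xi eta <->
    forall U : set Xbar, nbhs eta U ->
      exists (x y : nat -> X) (C : R),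
        [/\ 0 <= C,
            i (x n) @[n --> \oo] --> xi,
            (\forall n \near \oo, U (i (y n))) &
            forall n : nat, mdist (y n) (x n) <= mdist (y n) x0 + C].
  split=> [star_eta U Ueta|seqs U Ueta].
    (* the interior of [U] is a neighborhood of any of its points, hence of the
       approximating point [p] and not only of [eta] *)
    have Ueta' : nbhs eta U° by exact: nbhs_interior.
    have [p [[C C0 Hp] Up]] := star_eta _ Ueta'.
    have [x [y [xxi Uy le_yx]]] :=
      limit_halfspaces_sequences x0 i xi densei fcXbar Hp Up.
    by exists x, y, (C + 1); split; [exact: addr_ge0|by []|exact: nearW|by []].
  have [U' U'eta clU'U] :=
    compact_regular hausXbar compactXbar filterT Ueta.
  have [x [y [C [C0 xxi U'y le_yx]]]] := seqs _ U'eta.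
  have [p [_ clp]] := compactXbar (i (y n) @[n --> \oo]) _ filterT.
  exists p; split; last by apply: clU'U => N Np; exact: clp.
  by exists C => //; exact: (cluster_limit_halfspaces x0 i xi xxi le_yx).
split=> // -[C [x [y [C0 xxi yeta le_yx]]]]; apply/starP => U Ueta.
by exists x, y, C; split=> //; exact: yeta.
Qed.
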